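(* Let $E$ be a normalized symmetric Banach sequence space with order continuous norm. Then the homomorphism $p \colon \mathrm{Aut}^+_s(E) \to S(\mathbb{N})$ is continuous.
   Context: A normalized symmetric Banach sequence space is a Banach lattice $E$ of real sequences (indexed by $\mathbb{N}$), with the pointwise ordering and lattice operations, such that: if $x\in E$ and $y$ is a sequence with $|y|\le|x|$, then $y\in E$ and $\|y\|\le\|x\|$; permutations of sequences in $E$ remain in $E$ with the same norm; and the standard unit vectors $e_n$ ($n\in\mathbb{N}$) have norm $1$. $\mathrm{Aut}^+_s(E)$ is the group of lattice automorphisms of $E$ with the strong operator topology. $S(\mathbb{N})$ is the group of permutations of $\mathbb{N}$, identified with the group of permutation operators on $E$, $(\phi x)_n := x_{\phi^{-1}(n)}$, with the strong operator topology as a subset of $\mathrm{Aut}^+_s(E)$. $(\ell^\infty)^{++}$ is the set of $m\in\ell^\infty$ for which there is a $\delta>0$ with $m_n\ge\delta$ for all $n$, identified with multiplication operators on $E$. Every lattice automorphism $T$ of $E$ can be written uniquely as $T=m\phi$ with $m\in(\ell^\infty)^{++}$ and $\phi\in S(\mathbb{N})$, and $p$ is the group homomorphism $p(m\phi):=\phi$. *)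

(* Defs.v *)
From HB Require Import structures.
From mathcomp Require Import all_boot all_order all_algebra.
From mathcomp Require Import all_classical all_reals all_analysis.
From mathcomp Require Import ring lra.

Set Implicit Arguments.
Unset Strict Implicit.
Unset Printing Implicit Defensive.

Import Order.TTheory GRing.Theory Num.Theory.
Import numFieldNormedType.Exports.

Local Open Scope classical_set_scope.
Local Open Scope ring_scope.

Record nat_perm := NatPerm {
  perm_fun :> nat -> nat;
  perm_inv : nat -> nat;
  perm_funK : cancel perm_fun perm_inv;
  perm_invK : cancel perm_inv perm_fun
}.

Lemma nat_perm_ext (s t : nat_perm) : s =1 t -> s = t.
Proof.
case: s t => [f g fK gK] [f' g' fK' gK'] /= /funext ff'; subst f'.
have gg' : g = g' by apply/funext => n; rewrite -{1}[n]gK' fK.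
by subst g'; congr NatPerm; exact: Prop_irrelevance.
Qed.

Definition perm_one : nat_perm :=
  @NatPerm id id (fun=> erefl) (fun=> erefl).

Definition perm_opp (s : nat_perm) : nat_perm :=
  NatPerm (@perm_invK s) (@perm_funK s).

Definition perm_comp (s t : nat_perm) : nat_perm :=
  NatPerm (can_comp (@perm_funK s) (@perm_funK t))
          (can_comp (@perm_invK t) (@perm_invK s)).

Fact perm_compA : associative perm_comp.
Proof. by move=> s t u; exact: nat_perm_ext. Qed.

Fact perm_comp1g : left_id perm_one perm_comp.
Proof. by move=> s; exact: nat_perm_ext. Qed.

Fact perm_compg1 : right_id perm_one perm_comp.
Proof. by move=> s; exact: nat_perm_ext. Qed.

Fact perm_compVg : left_inverse perm_one perm_opp perm_comp.
Proof. by move=> s; apply: nat_perm_ext => n /=; exact: perm_funK. Qed.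

Fact perm_compgV : right_inverse perm_one perm_opp perm_comp.
Proof. by move=> s; apply: nat_perm_ext => n /=; exact: perm_invK. Qed.

HB.instance Definition _ := gen_eqMixin nat_perm.
HB.instance Definition _ := gen_choiceMixin nat_perm.
HB.instance Definition _ := isGroup.Build nat_perm
  perm_compA perm_comp1g perm_compg1 perm_compVg perm_compgV.

(* [E] is a linear subspace [P] of R^N, together with a complete norm;
   [\val] is the inclusion into R^N. *)
HB.mixin Record isSymmetricSeqSpace (R : realType) (P : pred (nat -> R)) E
    of @GRing.SubLmodule R (nat -> R) P E & CompleteNormedModule R E := {
  seq_solid : forall (x : E) (y : nat -> R),
    (forall n, `|y n| <= `|(\val x : nat -> R) n|) ->
    exists2 z : E, \val z = y & `|z| <= `|x|;
  seq_symmetric : forall (x : E) (s : nat_perm),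
    exists2 z : E, \val z = (\val x : nat -> R) \o s & `|z| = `|x|;
  seq_unit : forall k : nat,
    exists2 z : E, \val z = (fun n => (n == k)%:R) & `|z| = 1
}.

#[short(type="symSeqSpaceType")]
HB.structure Definition SymSeqSpace (R : realType) (P : pred (nat -> R)) :=
  {E of @GRing.SubLmodule R (nat -> R) P E & CompleteNormedModule R E
      & isSymmetricSeqSpace R P E}.

Section SeqSpace.
Context (R : realType) (P : pred (nat -> R)) (E : symSeqSpaceType P).
Implicit Types (x y z : E) (s : nat_perm).

Definition entry x : nat -> R := \val x.

Lemma entry_inj : injective entry. Proof. exact: val_inj. Qed.

Lemma entryD x y n : entry (x + y) n = entry x n + entry y n.
Proof. by rewrite /entry raddfD. Qed.

Lemma entryN x n : entry (- x) n = - entry x n.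
Proof. by rewrite /entry raddfN. Qed.

Lemma entryB x y n : entry (x - y) n = entry x n - entry y n.
Proof. by rewrite entryD entryN. Qed.

Lemma entry0 n : entry 0 n = 0.
Proof. by rewrite /entry raddf0. Qed.

Lemma entryZ a x n : entry (a *: x) n = a * entry x n.
Proof. by rewrite /entry linearZ. Qed.

(* The element of [E] with coordinates [y]; junk value 0 when there is none. *)
Definition of_seq (y : nat -> R) : E := insubd 0 y.

Lemma of_seqK x (y : nat -> R) : entry x = y -> entry (of_seq y) = y.
Proof. by move=> <-; rewrite /of_seq /entry valKd. Qed.

Definition seq_le x y := forall n, entry x n <= entry y n.
Definition seq_sup x y : E := of_seq (entry x \max entry y).
Definition seq_inf x y : E := of_seq (entry x \min entry y).

Lemma solid_of_seq x (y : nat -> R) : (forall n, `|y n| <= `|entry x n|) ->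
  entry (of_seq y) = y.
Proof. by move=> /seq_solid[z zy _]; exact: (of_seqK zy). Qed.

Lemma entry_abs x : entry (of_seq (fun n => `|entry x n|)) =
  fun n => `|entry x n|.
Proof. by apply: (@solid_of_seq x) => n; rewrite normr_id. Qed.

Lemma entry_sup x y : entry (seq_sup x y) = entry x \max entry y.
Proof.
apply: (@solid_of_seq (of_seq (fun n => `|entry x n|) +
                       of_seq (fun n => `|entry y n|))) => n.
rewrite entryD !entry_abs /= [leRHS]ger0_norm ?addr_ge0//.
by rewrite ?maxEle ?minEle; case: ifP => _; rewrite ?lerDl ?lerDr normr_ge0.
Qed.

Lemma entry_inf x y : entry (seq_inf x y) = entry x \min entry y.
Proof.
apply: (@solid_of_seq (of_seq (fun n => `|entry x n|) +
                       of_seq (fun n => `|entry y n|))) => n.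
rewrite entryD !entry_abs /= [leRHS]ger0_norm ?addr_ge0//.
by rewrite ?maxEle ?minEle; case: ifP => _; rewrite ?lerDl ?lerDr normr_ge0.
Qed.

Definition directed (I : Type) (r : I -> I -> Prop) :=
  [/\ inhabited I, forall i, r i i, forall j i k, r i j -> r j k -> r i k
    & forall i j, exists2 k, r i k & r j k].

(* Every net in [E] decreasing to 0 has norms converging to 0. *)
Definition order_continuous_norm :=
  forall (I : Type) (r : I -> I -> Prop) (x : I -> E),
    directed r ->
    (forall i j, r i j -> seq_le (x j) (x i)) ->
    (forall i, seq_le 0 (x i)) ->
    (forall l : E, (forall i, seq_le l (x i)) -> seq_le l 0) ->
    forall e : R, 0 < e -> exists i, forall j, r i j -> `|x j| < e.

Record lattice_aut := LatticeAut {
  aut_fun :> E -> E;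
  aut_inv : E -> E;
  aut_linear : linear aut_fun;
  aut_sup : {morph aut_fun : x y / seq_sup x y};
  aut_inf : {morph aut_fun : x y / seq_inf x y};
  aut_funK : cancel aut_fun aut_inv;
  aut_invK : cancel aut_inv aut_fun
}.
Implicit Types S T : lattice_aut.

Lemma lattice_aut_ext S T : S =1 T -> S = T.
Proof.
case: S T => [f g a b c fK gK] [f' g' a' b' c' fK' gK'] /= /funext ff'.
subst f'.
have gg' : g = g' by apply/funext => n; rewrite -{1}[n]gK' fK.
by subst g'; congr LatticeAut; exact: Prop_irrelevance.
Qed.

Definition aut_one : lattice_aut :=
  @LatticeAut id id (fun _ _ _ => erefl) (fun _ _ => erefl)
    (fun _ _ => erefl) (fun=> erefl) (fun=> erefl).

Fact aut_inv_linear T : linear (aut_inv T).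
Proof.
by move=> a x y; apply: (can_inj (@aut_funK T)); rewrite aut_linear !aut_invK.
Qed.

Fact aut_inv_sup T : {morph aut_inv T : x y / seq_sup x y}.
Proof.
by move=> x y; apply: (can_inj (@aut_funK T)); rewrite aut_sup !aut_invK.
Qed.

Fact aut_inv_inf T : {morph aut_inv T : x y / seq_inf x y}.
Proof.
by move=> x y; apply: (can_inj (@aut_funK T)); rewrite aut_inf !aut_invK.
Qed.

Definition aut_opp T : lattice_aut :=
  LatticeAut (@aut_inv_linear T) (@aut_inv_sup T) (@aut_inv_inf T)
    (@aut_invK T) (@aut_funK T).

Fact aut_comp_linear S T : linear (S \o T).
Proof. by move=> a x y /=; rewrite !aut_linear. Qed.

Fact aut_comp_sup S T : {morph S \o T : x y / seq_sup x y}.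
Proof. by move=> x y /=; rewrite !aut_sup. Qed.

Fact aut_comp_inf S T : {morph S \o T : x y / seq_inf x y}.
Proof. by move=> x y /=; rewrite !aut_inf. Qed.

Definition aut_comp S T : lattice_aut :=
  LatticeAut (@aut_comp_linear S T) (@aut_comp_sup S T) (@aut_comp_inf S T)
    (can_comp (@aut_funK S) (@aut_funK T))
    (can_comp (@aut_invK T) (@aut_invK S)).

Fact aut_compA : associative aut_comp.
Proof. by move=> S T U; exact: lattice_aut_ext. Qed.

Fact aut_comp1g : left_id aut_one aut_comp.
Proof. by move=> S; exact: lattice_aut_ext. Qed.

Fact aut_compg1 : right_id aut_one aut_comp.
Proof. by move=> S; exact: lattice_aut_ext. Qed.

Fact aut_compVg : left_inverse aut_one aut_opp aut_comp.
Proof. by move=> S; apply: lattice_aut_ext => x /=; exact: aut_funK. Qed.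

Fact aut_compgV : right_inverse aut_one aut_opp aut_comp.
Proof. by move=> S; apply: lattice_aut_ext => x /=; exact: aut_invK. Qed.

HB.instance Definition _ := gen_eqMixin lattice_aut.
HB.instance Definition _ := gen_choiceMixin lattice_aut.
HB.instance Definition _ := isGroup.Build lattice_aut
  aut_compA aut_comp1g aut_compg1 aut_compVg aut_compgV.

(* Strong operator topology: pointwise convergence in the norm of [E]. *)
HB.instance Definition _ := Topological.copy lattice_aut
  (initial_topology (aut_fun : lattice_aut -> {ptws E -> E})).

Definition perm_fun_op s x : E := of_seq (entry x \o perm_inv s).

Lemma entry_perm s x n : entry (perm_fun_op s x) n = entry x (perm_inv s n).
Proof.
have [z zx _] := seq_symmetric x (perm_opp s).
by rewrite /perm_fun_op (of_seqK zx).
Qed.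

Fact perm_op_linear s : linear (perm_fun_op s).
Proof.
move=> a x y; apply/entry_inj/funext => n.
by rewrite entry_perm !entryD !entryZ !entry_perm.
Qed.

Fact perm_op_sup s : {morph perm_fun_op s : x y / seq_sup x y}.
Proof.
move=> x y; apply/entry_inj/funext => n.
by rewrite entry_perm !entry_sup /= !entry_perm.
Qed.

Fact perm_op_inf s : {morph perm_fun_op s : x y / seq_inf x y}.
Proof.
move=> x y; apply/entry_inj/funext => n.
by rewrite entry_perm !entry_inf /= !entry_perm.
Qed.

Fact perm_op_funK s : cancel (perm_fun_op s) (perm_fun_op (perm_opp s)).
Proof.
by move=> x; apply/entry_inj/funext => n; rewrite !entry_perm /= perm_funK.
Qed.

Fact perm_op_invK s : cancel (perm_fun_op (perm_opp s)) (perm_fun_op s).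
Proof.
by move=> x; apply/entry_inj/funext => n; rewrite !entry_perm /= perm_invK.
Qed.

Definition perm_op s : lattice_aut :=
  LatticeAut (@perm_op_linear s) (@perm_op_sup s) (@perm_op_inf s)
    (@perm_op_funK s) (@perm_op_invK s).

(* The multipliers (l^oo)^{++}. *)
Definition linf_pp : set (nat -> R) :=
  [set m | (exists M, forall n, `|m n| <= M) /\
           (exists2 d, 0 < d & forall n, d <= m n)].

(* T = m s, where [m] acts on [E] by pointwise multiplication. *)
Definition decomposes T (m : nat -> R) s :=
  linf_pp m /\ forall x n, entry (T x) n = m n * entry (perm_op s x) n.

End SeqSpace.

(* S(N) with the topology it inherits as a subset of the automorphism group. *)
Definition perm_s (R : realType) (P : pred (nat -> R))
  (E : symSeqSpaceType P) := initial_topology (@perm_op R P E).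
HB.instance Definition _ (R : realType) (P : pred (nat -> R))
  (E : symSeqSpaceType P) := Topological.on (perm_s E).
HB.instance Definition _ (R : realType) (P : pred (nat -> R))
  (E : symSeqSpaceType P) := Group.copy (perm_s E) nat_perm.

Section Decomposition.
Context (R : realType) (P : pred (nat -> R)) (E : symSeqSpaceType P).
Implicit Types (x y z : E) (s : nat_perm) (S T : lattice_aut E).

Definition unit_vec k : E := of_seq E (fun n => (n == k)%:R).

Lemma entry_unit k n : entry (unit_vec k) n = (n == k)%:R.
Proof. by have [z ze _] := @seq_unit R P E k; rewrite (of_seqK ze). Qed.

Lemma norm_unit k : `|unit_vec k| = 1.
Proof.
have [z ze <-] := @seq_unit R P E k.
by congr (`| _ |); apply/entry_inj/funext => n; rewrite entry_unit [entry z]ze.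
Qed.

Lemma entry_le_norm x n : `|entry x n| <= `|x|.
Proof.
have -> : `|entry x n| = `|entry x n *: unit_vec n|.
  by rewrite normrZ norm_unit mulr1.
have [k|z zE zx] := @seq_solid R P E x (entry (entry x n *: unit_vec n)).
  rewrite entryZ entry_unit; case: eqP => [->|_].
    by rewrite mulr1.
  by rewrite mulr0 normr0.
by rewrite -(entry_inj zE).
Qed.

Lemma autD T x y : T (x + y) = T x + T y.
Proof. by rewrite -[x]scale1r aut_linear !scale1r. Qed.

Lemma aut0 T : T 0 = 0.
Proof. by apply: (@addrI _ (T 0)); rewrite -autD !addr0. Qed.

Lemma autZ T a x : T (a *: x) = a *: T x.
Proof. by rewrite -[a *: x]addr0 aut_linear aut0 addr0. Qed.

Lemma aut_le T x y : seq_le x y -> seq_le (T x) (T y).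
Proof.
move=> xy n; have -> : T y = seq_sup (T x) (T y).
  rewrite -aut_sup; congr (T _); apply/entry_inj/funext => k.
  by rewrite entry_sup /=; apply/esym/max_idPr.
by rewrite entry_sup /= le_max lexx.
Qed.

Lemma aut_pos T x : seq_le 0 x -> seq_le 0 (T x).
Proof. by move=> /(aut_le T); rewrite aut0. Qed.

Lemma unit_pos k : seq_le 0 (unit_vec k).
Proof. by move=> n; rewrite entry0 entry_unit ler0n. Qed.

Lemma aut_unit T k : exists b : R * nat, 0 < b.1 /\
  T (unit_vec k) = b.1 *: unit_vec b.2.
Proof.
have [j Tj] : exists j, 0 < entry (T (unit_vec k)) j.
  apply: contrapT => /forallNP h.
  have T0 : T (unit_vec k) = 0.
    apply/entry_inj/funext => n; apply/eqP; rewrite eq_le.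
    by rewrite (@aut_pos T _ (unit_pos k)) andbT entry0 leNgt; apply/negP/h.
  have : entry (unit_vec k) k = 0.
    by rewrite -[unit_vec k](aut_funK T) T0 -(aut0 T) aut_funK entry0.
  by rewrite entry_unit eqxx => /eqP; rewrite oner_eq0.
set c := entry (T (unit_vec k)) j in Tj.
have S1 : seq_le 0 (aut_opp T (unit_vec j)) by exact/aut_pos/unit_pos.
have S2 : seq_le (c *: aut_opp T (unit_vec j)) (unit_vec k).
  rewrite -autZ -[X in seq_le _ X](aut_funK T).
  apply: (@aut_le (aut_opp T)) => n.
  rewrite entryZ entry_unit; case: eqP => [->|_]; first by rewrite mulr1.
  by rewrite mulr0 -(entry0 E n); apply/aut_pos/unit_pos.
set a := entry (aut_opp T (unit_vec j)) k.
have Sa : aut_opp T (unit_vec j) = a *: unit_vec k.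
  apply/entry_inj/funext => n; rewrite entryZ entry_unit.
  case: eqP => [->|nk]; first by rewrite mulr1.
  apply/eqP; rewrite mulr0 eq_le -[X in _ && (X <= _)](entry0 E n) S1 andbT.
  have := S2 n; rewrite entryZ entry_unit; case: eqP => // _.
  by rewrite pmulr_rle0.
have ej : unit_vec j = a *: T (unit_vec k).
  by rewrite -autZ -Sa /= aut_invK.
have a0 : a != 0.
  apply/eqP => a0; have := congr1 (fun x => entry x j) ej.
  by rewrite a0 scale0r entry0 entry_unit eqxx => /eqP; rewrite oner_eq0.
have ap : 0 < a by rewrite lt_neqAle eq_sym a0 -(entry0 E k) S1.
exists (a^-1, j); split => /=; first by rewrite invr_gt0.
by rewrite ej scalerA mulVf // scale1r.
Qed.

Definition aut_coef T k : R := (sval (cid (aut_unit T k))).1.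
Definition aut_index T k : nat := (sval (cid (aut_unit T k))).2.

Lemma aut_coef_gt0 T k : 0 < aut_coef T k.
Proof. by rewrite /aut_coef; case: cid => b []. Qed.

Lemma aut_unitE T k : T (unit_vec k) = aut_coef T k *: unit_vec (aut_index T k).
Proof. by rewrite /aut_coef /aut_index; case: cid => b []. Qed.

Lemma unit_scale_inj a b j k : a != 0 ->
  a *: unit_vec j = b *: unit_vec k -> a = b /\ j = k.
Proof.
move=> a0 /(congr1 (fun x => entry x j)); rewrite !entryZ !entry_unit eqxx mulr1.
case: eqP => [->|_]; first by rewrite mulr1.
by rewrite mulr0 => /eqP; rewrite (negPf a0).
Qed.

Lemma aut_oppP T k : aut_coef T k * aut_coef (aut_opp T) (aut_index T k) = 1 /\
  aut_index (aut_opp T) (aut_index T k) = k.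
Proof.
have : aut_opp T (T (unit_vec k)) = 1 *: unit_vec k by rewrite scale1r /= aut_funK.
rewrite aut_unitE autZ aut_unitE scalerA => /unit_scale_inj; apply.
by rewrite mulf_neq0 // gt_eqF // aut_coef_gt0.
Qed.

Lemma aut_oppP' T k : aut_coef (aut_opp T) k * aut_coef T (aut_index (aut_opp T) k) = 1 /\
  aut_index T (aut_index (aut_opp T) k) = k.
Proof.
have : T (aut_opp T (unit_vec k)) = 1 *: unit_vec k by rewrite scale1r /= aut_invK.
rewrite aut_unitE autZ aut_unitE scalerA => /unit_scale_inj; apply.
by rewrite mulf_neq0 // gt_eqF // aut_coef_gt0.
Qed.

Definition aut_perm T : nat_perm :=
  @NatPerm (aut_index T) (aut_index (aut_opp T))
    (fun k => (aut_oppP T k).2) (fun k => (aut_oppP' T k).2).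

Definition aut_mult T k : R := aut_coef T (aut_index (aut_opp T) k).

Lemma aut_mult_gt0 T k : 0 < aut_mult T k.
Proof. exact: aut_coef_gt0. Qed.

Lemma entry_unit_le T x k : seq_le 0 x ->
  aut_coef T k * entry x k <= entry (T x) (aut_index T k).
Proof.
move=> x0; have /(aut_le T)/(_ (aut_index T k)) :
    seq_le (entry x k *: unit_vec k) x.
  move=> n; rewrite entryZ entry_unit; case: eqP => [->|_].
    by rewrite mulr1.
  by rewrite mulr0 -(entry0 E n).
by rewrite autZ aut_unitE !entryZ entry_unit eqxx mulr1 mulrC.
Qed.

Lemma entry_aut_pos T x n : seq_le 0 x ->
  entry (T x) n = aut_mult T n * entry x (aut_index (aut_opp T) n).
Proof.
move=> x0; apply/eqP; rewrite eq_le; apply/andP; split; last first.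
  have := entry_unit_le T (aut_index (aut_opp T) n) x0.
  by rewrite (aut_oppP' T n).2.
have := entry_unit_le (aut_opp T) n (@aut_pos T _ x0).
rewrite /= aut_funK => /(ler_wpM2l (ltW (aut_mult_gt0 T n))).
by rewrite mulrA [_ * aut_coef _ _]mulrC (aut_oppP' T n).1 mul1r.
Qed.

Lemma entry_aut T x n :
  entry (T x) n = aut_mult T n * entry x (aut_index (aut_opp T) n).
Proof.
pose u := seq_sup x 0; pose v := u - x.
have u0 : seq_le 0 u by move=> k; rewrite entry_sup /= le_max lexx orbT.
have v0 : seq_le 0 v.
  by move=> k; rewrite entry0 entryB subr_ge0 entry_sup /= le_max lexx.
have -> : x = u + (-1) *: v by rewrite scaleN1r /v opprB addrC subrK.
by rewrite autD autZ !entryD !entryZ !entry_aut_pos //; ring.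
Qed.

Lemma aut_mult_bounded T : exists M, forall n, aut_mult T n <= M.
Proof.
apply: contrapT => /forallNP h.
have {}h j : exists k, (4 ^+ j : R) < aut_mult T k.
  have /existsNP[k /negP] := h (4 ^+ j); rewrite -ltNge => hk.
  by exists k.
pose k j := sval (cid (h j)).
have kP j : (4 ^+ j : R) < aut_mult T (k j) by exact: (svalP (cid (h j))).
pose i j := aut_index (aut_opp T) (k j).
pose w : E ^nat := fun j => (2^-1 : R) ^+ j *: unit_vec (i j).
have w0 j : seq_le 0 (w j).
  by move=> n; rewrite entry0 entryZ entry_unit mulr_ge0 // exprn_ge0.
have /cvg_ex[x wx] : cvgn (series w).
  apply: normed_cvg; rewrite (_ : [normed series w] = series (geometric 1 2^-1)).
    by apply: is_cvg_geometric_series; rewrite ger0_norm // invf_lt1 // ltr1n.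
  congr series; apply/funext => j /=.
  by rewrite normrZ norm_unit mulr1 mul1r normrX ger0_norm.
have xge j : (2^-1 : R) ^+ j <= entry x (i j).
  rewrite leNgt; apply/negP => xj; pose e := (2^-1 : R) ^+ j - entry x (i j).
  have e0 : 0 < e by rewrite subr_gt0.
  move/cvgrPdist_lt : wx => /(_ _ e0) [N _ /(_ (N + j.+1)%N)] /=.
  rewrite leq_addr => /(_ isT); set y := series w _.
  suff yj : (2^-1 : R) ^+ j <= entry y (i j).
    move=> /(le_lt_trans (entry_le_norm _ (i j))); rewrite entryB.
    by rewrite distrC ger0_norm /e; lra.
  rewrite /y; elim: N {y} => [|N IH].
    rewrite add0n seriesSr entryD entryZ entry_unit eqxx mulr1 lerDr.
    move: (i j) => q; elim: j {xj e e0} => [|j IHj].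
      by rewrite /series /= big_geq // entry0.
    by rewrite seriesSr entryD addr_ge0 // -(entry0 E q) w0.
  rewrite addSn seriesSr entryD; apply: le_trans IH _.
  by rewrite lerDl -(entry0 E (i j)) w0.
have big j : (2 : R) ^+ j <= `|T x|.
  apply: le_trans (entry_le_norm _ (k j)).
  apply: le_trans (ler_norm _); rewrite entry_aut.
  apply: le_trans (_ : 4 ^+ j * 2^-1 ^+ j <= _).
    by rewrite -exprMn (_ : 4 * 2^-1 = 2 :> R) //; lra.
  by rewrite ler_pM // ?exprn_ge0 // ?(ltW (kP j)) //; exact: xge.
have /(_ `|T x|) : forall a : R, exists j, a < 2 ^+ j.
  move=> a; exists (Num.truncn a).+1.
  apply: lt_le_trans (truncnS_gt a) _.
  by rewrite -natrX ler_nat ltnW // ltn_expl.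
by move=> [j]; rewrite ltNge big.
Qed.

Lemma decomposition_exists T : decomposes T (aut_mult T) (aut_perm T).
Proof.
split; last by move=> x n; rewrite entry_perm entry_aut.
split.
  have [M TM] := aut_mult_bounded T; exists M => n.
  by rewrite ger0_norm // ltW // aut_mult_gt0.
have [M TM] := aut_mult_bounded (aut_opp T).
have M0 : 0 < M by apply: lt_le_trans (TM 0%N); exact: aut_mult_gt0.
exists M^-1; first by rewrite invr_gt0.
move=> n; have [+ _] := aut_oppP' T n => h.
have {h} : aut_coef (aut_opp T) n * aut_mult T n = 1 by [].
have : aut_coef (aut_opp T) n <= M.
  have := TM (aut_index (aut_opp T) n).
  rewrite /aut_mult.
  have -> : aut_opp (aut_opp T) = T by apply: lattice_aut_ext.
  by rewrite (aut_oppP' T n).2.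
move=> cM cm; rewrite -div1r ler_pdivrMr // -cm mulrC.
by rewrite ler_wpM2l // ltW // aut_mult_gt0.
Qed.

Lemma decomposition_unique T m m' s s' :
  decomposes T m s -> decomposes T m' s' -> m = m' /\ s = s'.
Proof.
move=> [[_ [d d0 md]] h] [[_ [d' d'0 md']] h'].
have E2 k n : m n * (perm_inv s n == k)%:R = m' n * (perm_inv s' n == k)%:R.
  by have := h (unit_vec k) n; rewrite h' !entry_perm !entry_unit.
have mm n : m n = m' n /\ perm_inv s n = perm_inv s' n.
  have := E2 (perm_inv s n) n; rewrite eqxx mulr1.
  case: eqP => [e|_]; first by rewrite mulr1 => ->; rewrite e.
  by move=> mn; have := lt_le_trans d0 (md n); rewrite mn mulr0 ltxx.
split; first by apply/funext => n; case: (mm n).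
apply: nat_perm_ext => n.
by rewrite -{1}[n](perm_funK s') -(mm _).2 perm_invK.
Qed.

End Decomposition.

Section PermutationPart.
Context (R : realType) (P : pred (nat -> R)) (E : symSeqSpaceType P).
Implicit Types (S T : lattice_aut E).

Fact decomposition T : exists s, exists m, decomposes T m s.
Proof. by exists (aut_perm T), (aut_mult T); exact: decomposition_exists. Qed.

Definition perm_part T : perm_s E := sval (cid (decomposition T)).

Lemma perm_partP T : exists m, decomposes T m (perm_part T).
Proof. exact: (svalP (cid (decomposition T))). Qed.

Lemma perm_partE T m s : decomposes T m s -> perm_part T = s.
Proof.
by have [m' Tm'] := perm_partP T => /(decomposition_unique Tm')[].
Qed.

Lemma perm_partM : {morph perm_part : S T / (S * T)%g >-> (S * T)%g}.
Proof.
move=> S T; have [m [[[M mM] [d d0 dm]] mE]] := perm_partP S.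
have [m' [[[M' mM'] [d' d'0 dm']] mE']] := perm_partP T.
apply: (@perm_partE _ (fun n => m n * m' (perm_inv (perm_part S) n))).
split; first split.
- exists (M * M') => n; rewrite normrM.
  by apply: ler_pM => //; exact: normr_ge0.
- exists (d * d'); first exact: mulr_gt0.
  by move=> n; apply: ler_pM => //; exact: ltW.
- move=> x n.
  change (entry (S (T x)) n = m n * m' (perm_inv (perm_part S) n) *
    entry (perm_op E (perm_comp (perm_part S) (perm_part T)) x) n).
  by rewrite mE !entry_perm mE' entry_perm /= mulrA.
Qed.

HB.instance Definition _ :=
  isMultiplicative.Build (lattice_aut E) (perm_s E) perm_part perm_partM.

End PermutationPart.

(* Main.v *)
(** Write [T = m s]. If [T] is close to [T0] on the unit vector [e_k], then
    [s k = s0 k]: otherwise [T e_k] and [T0 e_k] are supported at different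
    indices and their distance is at least the coefficient of [T0 e_k]. So [s]
    and [s0] agree on any given finite set of indices as soon as [T] is close
    to [T0] on finitely many vectors. Order continuity makes the finitely
    supported sequences dense in [E], and permutation operators are isometries,
    so agreement on finite sets gives strong convergence. *)

Require Import Defs.
From HB Require Import structures.
From mathcomp Require Import all_boot all_order all_algebra.
From mathcomp Require Import all_classical all_reals all_analysis.

Set Implicit Arguments.
Unset Strict Implicit.
Unset Printing Implicit Defensive.

Import Order.TTheory GRing.Theory Num.Theory.
Import numFieldNormedType.Exports.

Local Open Scope classical_set_scope.
Local Open Scope ring_scope.

(** A neighbourhood in an initial topology contains the preimage of an open set, so convergence can
    be tested after applying [f]. *)
Lemma cvg_initial (S : choiceType) (T : topologicalType) (f : S -> T)
    (F : set_system S) (s : initial_topology f) :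
  Filter F -> f @ F --> f s -> F --> s.
Proof.
move=> FF fF A [_ [[B Bop <-] Bfs BA]].
have FB : F (f @^-1` B) by apply: fF; exact: open_nbhs_nbhs.
exact: filterS BA FB.
Qed.

Section StrongTopology.
Context (R : realType) (P : pred (nat -> R)) (E : symSeqSpaceType P).
Implicit Types (x y : E) (s t : nat_perm) (S T : lattice_aut E).

Lemma cvg_strongP (F : set_system (lattice_aut E)) T : Filter F ->
  F --> T <-> forall x, (fun S => S x) @ F --> T x.
Proof.
move=> FF; split=> [FT x|FT].
  have FTf : {ptws, @aut_fun R P E @ F --> aut_fun T}.
    by move=> A /(@initial_continuous _ {ptws E -> E} (@aut_fun R P E) T)/FT.
  by have /pointwise_cvgP/(_ x) := FTf.
by apply: cvg_initial; apply/pointwise_cvgP => x; exact: FT.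
Qed.

Lemma norm_perm_op s x : `|perm_op E s x| = `|x|.
Proof.
have [z zx <-] := seq_symmetric x (perm_opp s).
by congr `|_|; apply/entry_inj/funext => n; rewrite entry_perm [entry z]zx.
Qed.

Lemma perm_partT T : perm_part T = aut_perm T.
Proof. exact/perm_partE/decomposition_exists. Qed.

Lemma aut_index_eq S T k :
  `|T (unit_vec E k) - S (unit_vec E k)| < aut_coef T k ->
  aut_index S k = aut_index T k.
Proof.
move=> ST; apply/eqP; apply: contraTT ST => ne; rewrite -leNgt.
(* For distinct indices this entry of the difference is exactly [aut_coef T k]. *)
apply: le_trans (entry_le_norm _ (aut_index T k)).
rewrite entryB !aut_unitE !entryZ !entry_unit eqxx eq_sym (negPf ne).
by rewrite mulr1 mulr0 subr0 ler_norm.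
Qed.

Lemma aut_index_near T k :
  \forall S \near T, aut_index S k = aut_index T k.
Proof.
have /cvg_strongP/(_ (unit_vec E k))/cvgrPdist_lt : nbhs T --> T by [].
move=> /(_ _ (aut_coef_gt0 T k)) /=.
by apply: filterS => S; exact: aut_index_eq.
Qed.

Definition tail x n : E :=
  of_seq E (fun k => if (k < n)%N then 0 else entry x k).

Lemma entry_tail x n k :
  entry (tail x n) k = if (k < n)%N then 0 else entry x k.
Proof.
rewrite /tail (@solid_of_seq _ _ _ x) // => {}k.
by case: ifP; rewrite ?normr0.
Qed.

(** Order continuity speaks of positive decreasing nets, so it is applied to the tails of [|x|];
    solidity carries the bound back to [x]. *)
Lemma norm_tail_abs x n :
  `|tail (of_seq E (fun k => `|entry x k|)) n| = `|tail x n|.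
Proof.
set a := of_seq _ _.
have aE k : entry a k = `|entry x k| by rewrite /a entry_abs.
have le_norm u v :
    (forall k, `|entry u k| = `|entry v k|) -> `|u : E| <= `|v : E|.
  move=> uv; have [|z zu zv] := @seq_solid R P E v (entry u).
    by move=> k; rewrite uv.
  by rewrite -(entry_inj zu).
apply/eqP; rewrite eq_le !le_norm // => k; rewrite !entry_tail aE;
  by case: ifP; rewrite ?normr_id.
Qed.

Lemma tail_small x (e : R) : order_continuous_norm E -> 0 < e ->
  exists n, `|tail x n| < e.
Proof.
move=> hE e0; pose a := of_seq E (fun k => `|entry x k|).
have a0 k : 0 <= entry a k by rewrite /a entry_abs.
have [| | | |n] := hE nat leq (tail a) _ _ _ _ e e0.
- split=> // [|n m k|i j]; first exact: (inhabits 0%N).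
    exact: leq_trans.
  by exists (maxn i j); rewrite ?leq_maxl ?leq_maxr.
- move=> i j ij k; rewrite !entry_tail.
  case: (ltnP k i) => ki; first by rewrite (leq_trans ki ij).
  by case: ifP.
- by move=> n k; rewrite entry0 entry_tail; case: ifP.
(* The tail from [k.+1] on vanishes at [k], so any lower bound is nonpositive there. *)
- by move=> l hl k; have := hl k.+1 k; rewrite entry_tail ltnSn entry0.
- by move=> /(_ n (leqnn n)); rewrite norm_tail_abs; exists n.
Qed.

Lemma perm_op_head s t x n : (forall k, (k < n)%N -> s k = t k) ->
  perm_op E s (x - tail x n) = perm_op E t (x - tail x n).
Proof.
(* Agreement below [n] passes to the inverses wherever [perm_inv s'] lands below [n]. *)
have head s' t' k : (forall k, (k < n)%N -> s' k = t' k) ->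
    (perm_inv s' k < n)%N -> perm_inv t' k = perm_inv s' k.
  by move=> st' /st'; rewrite perm_invK => kE; rewrite {1}kE perm_funK.
move=> st; apply/entry_inj/funext => k; rewrite !entry_perm.
have [sk|sk] := ltnP (perm_inv s k) n; first by rewrite (head s t).
have [tk|tk] := ltnP (perm_inv t k) n.
  by rewrite (head t s) // => j /st.
(* Both preimages of [k] are at least [n], where [x - tail x n] vanishes. *)
by rewrite !entryB !entry_tail !ltnNge sk tk /= !subrr.
Qed.

(** The heads [x - tail x n] have the same image and cancel; the two remaining tails are moved
    isometrically. *)
Lemma norm_perm_op_dist s t x n : (forall k, (k < n)%N -> s k = t k) ->
  `|perm_op E s x - perm_op E t x| <= `|tail x n| + `|tail x n|.
Proof.
move=> /(perm_op_head x); set y := tail x n => st.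
have -> : perm_op E s x - perm_op E t x = perm_op E s y - perm_op E t y.
  by rewrite -[in LHS](subrK y x) !(autD _ (x - y)) st opprD addrACA subrr
    add0r.
by apply: le_trans (ler_normB _ _) _; rewrite !norm_perm_op.
Qed.

End StrongTopology.

Theorem lemma5p2 (R : realType) (P : pred (nat -> R)) (E : symSeqSpaceType P)
    (hE : order_continuous_norm E) :
  continuous (@perm_part R P E : lattice_aut E -> perm_s E).
Proof.
move=> T; have FT : Filter (nbhs T) := nbhs_filter T.
apply: (@cvg_initial _ _ (@perm_op R P E)).
apply/cvg_strongP => x; apply/cvgrPdist_lt => e e0.
(* Half of [e], since the distance bound counts the tail twice. *)
have [|n xn] := @tail_small R P E x (e / 2) hE; first by rewrite divr_gt0.
have := filter_forall FT (fun k : 'I_n => aut_index_near T k).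
apply: filterS => S ST.
have /(norm_perm_op_dist x) TS k : (k < n)%N -> perm_part T k = perm_part S k.
  by move=> kn; rewrite !perm_partT /= (ST (Ordinal kn)).
by apply: le_lt_trans TS _; rewrite [ltRHS]splitr ltrD.
Qed.
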